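(* The subspace of the operad $\operatorname{PreLie}$ spanned by non-linear labeled rooted trees is an (operadic) ideal. The quotient of $\operatorname{PreLie}$ by this ideal is isomorphic to the associative operad $\operatorname{As}$, in such a way that the quotient map $\phi$ coincides with the usual map of operads from $\operatorname{PreLie}$ to $\operatorname{As}$.
   Context: All operads are symmetric operads in $\mathbb{Q}$-vector spaces. $\operatorname{PreLie}(n)$ (for $n\ge1$; $\operatorname{PreLie}(0)=0$) is the vector space with basis the rooted trees whose vertices are labeled bijectively by $\{1,\dots,n\}$, with $\mathfrak{S}_n$ acting by relabeling. Edges are oriented towards the root. For labeled rooted trees $T$, $S$ on vertex sets $I$, $J$ and $i\in I$, the composition of $S$ at the vertex $i$ of $T$ is $$T\circ_i S=\sum_f T\circ_i^f S,$$ a sum over all maps $f$ from the set of incoming edges of the vertex $i$ of $T$ to the set of vertices of $S$, where $T\circ_i^f S$ is obtained by replacing the vertex $i$ by the tree $S$ and grafting back the subtrees of $T$ previously attached to $i$ according to the map $f$ (with the usual relabeling when $I=\{1,\dots,m\}$, $J=\{1,\dots,n\}$). The unit is the tree with one vertex. The operad is generated by the binary operation $x\leftarrow y$, corresponding to the tree with root $1$ and one other vertex $2$; its algebras are (right) pre-Lie algebras, i.e. vector spaces with a bilinear product $\leftarrow$ such that $(x\leftarrow y)\leftarrow z-x\leftarrow(y\leftarrow z)$ is symmetric in $y,z$. A rooted tree is called linear if every vertex has at most one incoming edge, and non-linear otherwise. $\operatorname{As}$ is the operad of (non-unital) associative algebras. The usual map $\operatorname{PreLie}\to\operatorname{As}$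 is the operad morphism expressing that every associative algebra is a pre-Lie algebra: it sends the generator $x\leftarrow y$ to the associative product $xy$. *)

(* Defs.v *)
From HB Require Import structures.
From mathcomp Require Import all_boot all_order all_algebra all_fingroup.
From mathcomp Require Import generic_quotient ring_quotient.
From mathcomp Require Import zify.

Set Implicit Arguments.
Unset Strict Implicit.
Unset Printing Implicit Defensive.

Import GRing.Theory.
Local Open Scope ring_scope.
Local Open Scope quotient_scope.

(* The operations of a symmetric operad in Q-vector spaces, presented by
   partial compositions.  Ideals, quotients, morphisms and isomorphisms of
   operads depend on these operations only, so the associativity, unit and
   equivariance axioms are not recorded.
   Pitfalls: [op_comp i a b] is "a o_i b" for [a] of arity m+1, hence has
   arity (m+1)+n-1 = m+n; indices are numbered from 0; [op_act s] relabels the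
   input j as [s j]. *)
Record operad_data := OperadData {
  op_space :> nat -> lmodType rat;
  op_act : forall n, 'S_n -> op_space n -> op_space n;
  op_unit : op_space 1;
  op_comp : forall m n, 'I_m.+1 -> op_space m.+1 -> op_space n ->
    op_space (m + n);
  op_act_linear : forall n (s : 'S_n), linear (op_act s);
  op_comp_linearl : forall m n (i : 'I_m.+1) (b : op_space n),
    linear (fun a => op_comp i a b);
  op_comp_linearr : forall m n (i : 'I_m.+1) (a : op_space m.+1),
    linear (fun b : op_space n => op_comp i a b) }.

Definition is_operad_morphism (O P : operad_data)
    (phi : forall n, O n -> P n) : Prop :=
  [/\ forall n, linear (phi n),
      forall n (s : 'S_n) (a : O n), phi n (op_act s a) = op_act s (phi n a),
      phi 1%N (op_unit O) = op_unit P
    & forall m n (i : 'I_m.+1) (a : O m.+1) (b : O n),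
        phi (m + n)%N (op_comp i a b) = op_comp i (phi m.+1 a) (phi n b)].

Definition is_operad_isomorphism (O P : operad_data)
    (phi : forall n, O n -> P n) : Prop :=
  is_operad_morphism phi /\ forall n, bijective (phi n).

Record is_operad_ideal (O : operad_data) (I : forall n, {pred O n}) : Prop :=
  OperadIdeal {
    ideal_submod : forall n, submod_closed (I n);
    ideal_act : forall n (s : 'S_n) (a : O n),
      a \in I n -> op_act s a \in I n;
    ideal_compl : forall m n (i : 'I_m.+1) (a : O m.+1) (b : O n),
      a \in I m.+1 -> op_comp i a b \in I (m + n)%N;
    ideal_compr : forall m n (i : 'I_m.+1) (a : O m.+1) (b : O n),
      b \in I n -> op_comp i a b \in I (m + n)%N }.

Section QuotientSpace.
Variables (V : lmodType rat) (U : {pred V}).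

Definition subspace_pred of submod_closed U : {pred V} := U.

Hypothesis hU : submod_closed U.

HB.instance Definition _ :=
  GRing.isSubmodClosed.Build rat V (subspace_pred hU) hU.

Definition quotient_space := Quotient.quot (subspace_pred hU).
HB.instance Definition _ := GRing.Zmodule.on quotient_space.

Definition quotient_proj (x : V) : quotient_space := \pi_quotient_space x.

Lemma quotient_proj_eq x y :
  (quotient_proj x == quotient_proj y) = (x - y \in U).
Proof. exact: esym (Quotient.idealrBE _ x y). Qed.

Lemma quotient_projK (x : quotient_space) : quotient_proj (repr x) = x.
Proof. exact: reprK. Qed.

Lemma quotient_projD x y :
  quotient_proj (x + y) = quotient_proj x + quotient_proj y.
Proof. by rewrite /quotient_proj !piE. Qed.

Definition quotient_scale (c : rat) (x : quotient_space) : quotient_space :=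
  quotient_proj (c *: repr x).

Lemma quotient_projZ c x :
  quotient_proj (c *: x) = quotient_scale c (quotient_proj x).
Proof.
apply/eqP; rewrite quotient_proj_eq -scalerBr.
have hx : x - repr (quotient_proj x) \in subspace_pred hU.
  by rewrite -[_ \in _]quotient_proj_eq quotient_projK.
exact: (@rpredZ _ _ (subspace_pred hU)).
Qed.

Fact quotient_scaleA a b x :
  quotient_scale a (quotient_scale b x) = quotient_scale (a * b) x.
Proof. by rewrite -[x]quotient_projK -!quotient_projZ scalerA. Qed.

Fact quotient_scale1 : left_id 1 quotient_scale.
Proof. by move=> x; rewrite -[x]quotient_projK -!quotient_projZ scale1r. Qed.

Fact quotient_scaleDr : right_distributive quotient_scale +%R.
Proof.
move=> a x y; rewrite -[x]quotient_projK -[y]quotient_projK.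
by rewrite -quotient_projD -!quotient_projZ -quotient_projD scalerDr.
Qed.

Fact quotient_scaleDl x : {morph quotient_scale^~ x : a b / a + b}.
Proof.
move=> a b; rewrite -[x]quotient_projK.
by rewrite -!quotient_projZ -quotient_projD scalerDl.
Qed.

HB.instance Definition _ := GRing.Zmodule_isLmodule.Build rat quotient_space
  quotient_scaleA quotient_scale1 quotient_scaleDr quotient_scaleDl.

Lemma quotient_proj_linear : linear quotient_proj.
Proof. by move=> c x y; rewrite quotient_projD quotient_projZ. Qed.

End QuotientSpace.

Section QuotientOperad.
Variables (O : operad_data) (I : forall n, {pred O n}).
Arguments I : clear implicits.
Hypothesis hI : is_operad_ideal I.

Definition quotient_op_space n : lmodType rat :=
  quotient_space (ideal_submod hI n).

Definition quotient_op_proj n (a : O n) : quotient_op_space n :=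
  quotient_proj (ideal_submod hI n) a.

Definition quotient_op_act n (s : 'S_n) (x : quotient_op_space n) :=
  quotient_op_proj (op_act s (repr x)).

Definition quotient_op_comp m n (i : 'I_m.+1) (x : quotient_op_space m.+1)
    (y : quotient_op_space n) :=
  quotient_op_proj (op_comp i (repr x) (repr y)).

Lemma quotient_op_proj_linear n : linear (@quotient_op_proj n).
Proof. exact: quotient_proj_linear. Qed.

Lemma quotient_op_projK n (x : quotient_op_space n) :
  quotient_op_proj (repr x) = x.
Proof. exact: quotient_projK. Qed.

Lemma quotient_op_proj_eq n (a b : O n) :
  (quotient_op_proj a == quotient_op_proj b) = (a - b \in I n).
Proof. exact: quotient_proj_eq. Qed.

Lemma repr_quotient_op_proj n (a : O n) :
  repr (quotient_op_proj a) - a \in I n.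
Proof. by rewrite -quotient_op_proj_eq quotient_op_projK. Qed.

Lemma quotient_op_proj_act n (s : 'S_n) (a : O n) :
  quotient_op_proj (op_act s a) = quotient_op_act s (quotient_op_proj a).
Proof.
apply/eqP; rewrite eq_sym quotient_op_proj_eq.
have -> : op_act s (repr (quotient_op_proj a)) - op_act s a
        = op_act s (repr (quotient_op_proj a) - a).
  by rewrite addrC -scaleN1r -op_act_linear scaleN1r addrC.
exact/(ideal_act hI)/repr_quotient_op_proj.
Qed.

Lemma quotient_op_proj_comp m n (i : 'I_m.+1) (a : O m.+1) (b : O n) :
  quotient_op_proj (op_comp i a b)
  = quotient_op_comp i (quotient_op_proj a) (quotient_op_proj b).
Proof.
apply/eqP; rewrite eq_sym.
set a' := repr (quotient_op_proj a); set b' := repr (quotient_op_proj b).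
apply/eqP; transitivity (quotient_op_proj (op_comp i a' b)); apply/eqP;
  rewrite quotient_op_proj_eq.
- have -> : op_comp i a' b' - op_comp i a' b = op_comp i a' (b' - b).
    by rewrite addrC -scaleN1r -op_comp_linearr scaleN1r addrC.
  exact/(ideal_compr hI)/repr_quotient_op_proj.
- have -> : op_comp i a' b - op_comp i a b = op_comp i (a' - a) b.
    by rewrite addrC -scaleN1r -(op_comp_linearl i b) scaleN1r addrC.
  exact/(ideal_compl hI)/repr_quotient_op_proj.
Qed.

Fact quotient_op_act_linear n (s : 'S_n) : linear (@quotient_op_act n s).
Proof.
move=> c x y; rewrite -[x]quotient_op_projK -[y]quotient_op_projK.
by rewrite -quotient_op_proj_linear -!quotient_op_proj_act op_act_linear
           quotient_op_proj_linear.
Qed.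

Fact quotient_op_comp_linearl m n (i : 'I_m.+1) (y : quotient_op_space n) :
  linear (fun x => quotient_op_comp i x y).
Proof.
move=> c x x'; rewrite -[x]quotient_op_projK -[x']quotient_op_projK.
rewrite -[y]quotient_op_projK -quotient_op_proj_linear.
by rewrite -!quotient_op_proj_comp op_comp_linearl quotient_op_proj_linear.
Qed.

Fact quotient_op_comp_linearr m n (i : 'I_m.+1) (x : quotient_op_space m.+1) :
  linear (fun y : quotient_op_space n => quotient_op_comp i x y).
Proof.
move=> c y y'; rewrite -[y]quotient_op_projK -[y']quotient_op_projK.
rewrite -[x]quotient_op_projK -quotient_op_proj_linear.
by rewrite -!quotient_op_proj_comp op_comp_linearr quotient_op_proj_linear.
Qed.

Definition quotient_operad : operad_data :=
  OperadData (quotient_op_proj (op_unit O)) quotient_op_act_linear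
    quotient_op_comp_linearl quotient_op_comp_linearr.

Definition quotient_map n : O n -> quotient_operad n := @quotient_op_proj n.

Lemma quotient_map_morphism : is_operad_morphism quotient_map.
Proof.
split=> //; [exact: quotient_op_proj_linear | exact: quotient_op_proj_act |].
exact: quotient_op_proj_comp.
Qed.

End QuotientOperad.

Definition free_space (B : finType) : vectType rat := {ffun B -> rat^o}.

Definition basis_vec (B : finType) (b : B) : free_space B :=
  [ffun x => (x == b)%:R].

Definition lin_ext (B : finType) (V : lmodType rat) (f : B -> V)
    (a : free_space B) : V := \sum_x a x *: f x.

Fact lin_ext_linear (B : finType) (V : lmodType rat) (f : B -> V) :
  linear (lin_ext f).
Proof.
move=> c a b; rewrite /lin_ext scaler_sumr -big_split /=.
by apply: eq_bigr => x _; rewrite !ffunE scalerDl scalerA.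
Qed.

(* The relabelling of the inputs of a partial composition at [i]: an input
   v < i of the outer operation keeps its label, the input k of the inner
   operation becomes i + k, and an input v > i becomes v + n - 1. *)
Section Glue.
Variables (m n : nat) (i : 'I_m.+1).

Definition glue_nat (x : {v : 'I_m.+1 | v != i} + 'I_n) : nat :=
  match x with
  | inl v => if (val v < i)%N then nat_of_ord (val v)
             else ((val v : nat).-1 + n)%N
  | inr k => (i + k)%N
  end.

Fact glue_subproof x : (glue_nat x < m + n)%N.
Proof.
case: x => [[v nvi]|k] /=; last by have := ltn_ord i; have := ltn_ord k; lia.
have nvi' : (v : nat) != i by [].
by have := ltn_ord v; have := ltn_ord i; case: ifP; lia.
Qed.

Definition glue x : 'I_(m + n) := Ordinal (glue_subproof x).

Lemma glue_inj : injective glue.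
Proof.
move=> x y /(congr1 val) /=; case: x => [[v nv]|k]; case: y => [[w nw]|l] /= e.
- congr inl; apply/val_inj/val_inj => /=.
  have nv' : (v : nat) != i by []; have nw' : (w : nat) != i by [].
  by move: e; do 2!case: ifP; lia.
- have nv' : (v : nat) != i by [].
  by move: e (ltn_ord l); case: ifP; lia.
- have nw' : (w : nat) != i by [].
  by move: e (ltn_ord k); case: ifP; lia.
- by congr inr; apply/val_inj => /=; lia.
Qed.

Lemma card_glue : #|{: {v : 'I_m.+1 | v != i} + 'I_n}| = (m + n)%N.
Proof.
rewrite card_sum card_ord card_sig; congr (_ + _)%N.
by have := cardC1 i; rewrite card_ord /=; apply: etrans; apply: eq_card.
Qed.

Lemma glue_bij : bijective glue.
Proof. by apply: inj_card_bij glue_inj _; rewrite card_glue card_ord. Qed.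

End Glue.

Arguments glue {m n} i x.

Definition parent_map (V : finType) := {ffun V -> option V}.

(* Every vertex reaches the root [r] along the edges, oriented towards [r];
   this forces [p] to be acyclic and [r] to be its only root. *)
Definition is_rooted_tree (V : finType) (p : parent_map V) : bool :=
  [exists r, (p r == None) &&
    [forall v, connect (fun x y => p x == Some y) v r]].

Definition rtree (V : finType) := {p : parent_map V | is_rooted_tree p}.

Definition parent (V : finType) (T : rtree V) : parent_map V := val T.

Definition is_linear_tree (V : finType) (T : rtree V) : bool :=
  [forall v, (#|[set w | parent T w == Some v]| <= 1)%N].

Lemma connect_homo (V W : finType) (e : rel V) (e' : rel W) (h : V -> W) :
  (forall x y, e x y -> connect e' (h x) (h y)) ->
  forall x y, connect e x y -> connect e' (h x) (h y).
Proof.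
move=> he x y /connectP[p]; elim: p x => [|z p IHp] x /=.
  by move=> _ ->; apply: connect0.
by case/andP=> /he exz pz ey; apply: connect_trans exz (IHp _ pz ey).
Qed.

Lemma parent_irrefl (V : finType) (T : rtree V) v : parent T v != Some v.
Proof.
apply/eqP=> pv; case/existsP: (valP T) => r /andP[/eqP pr /forallP/(_ v)].
case/connectP=> s; move: pv; rewrite /parent => pv.
elim: s => [_ /= rv|w s IHs /= /andP[/eqP]]; first by rewrite -rv pr in pv.
by rewrite pv => -[<-].
Qed.

Section Relabel.
Variables (V W : finType) (h : V -> W).

Definition relabel_map (p : parent_map V) : parent_map W :=
  [ffun y => if [pick x | h x == y] is Some x then omap h (p x) else None].

Hypothesis hbij : bijective h.

Lemma relabel_mapE p x : relabel_map p (h x) = omap h (p x).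
Proof.
rewrite ffunE; case: pickP => [x' /eqP/(bij_inj hbij)-> //|/(_ x)].
by rewrite eqxx.
Qed.

Fact relabel_subproof (T : rtree V) : is_rooted_tree (relabel_map (parent T)).
Proof.
case/existsP: (valP T) => r /andP[/eqP pr /forallP conn].
apply/existsP; exists (h r); rewrite relabel_mapE /parent pr eqxx /=.
apply/forallP=> y; case: hbij => g hK gK; rewrite -(gK y).
apply: connect_homo (conn (g y)) => x x' /eqP e.
by apply: connect1; rewrite relabel_mapE /parent e.
Qed.

Definition relabel (T : rtree V) : rtree W :=
  exist (fun p : parent_map W => is_rooted_tree p) _ (relabel_subproof T).

End Relabel.

(* The edges entering a vertex [i] are identified with their sources. *)
Definition incoming (V : finType) (T : rtree V) (i : V) :=
  {v : V | parent T v == Some i}.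

Section Graft.
Variables (I J : finType) (T : rtree I) (i : I) (S : rtree J).
Variable f : {ffun incoming T i -> J}.

Definition skip_vertex (w : I) : option ({v : I | v != i} + J) :=
  omap inl (insub w).

Definition graft_map : parent_map ({v : I | v != i} + J)%type :=
  [ffun x => match x with
   | inl v => if insub (val v) is Some e then Some (inr (f e))
              else obind skip_vertex (parent T (val v))
   | inr k => if parent S k is Some l then Some (inr l)
              else obind skip_vertex (parent T i)
   end].

Fact graft_subproof : is_rooted_tree graft_map.
Proof.
case/existsP: (valP T) => r /andP[/eqP pr /forallP conn].
case/existsP: (valP S) => q /andP[/eqP pq /forallP connS].
pose e := fun x y => graft_map x == Some y.
pose emb w := odflt (inr q) (skip_vertex w).
have embi : emb i = inr q by rewrite /emb /skip_vertex insubF // eqxx.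
have skipN w : w != i -> skip_vertex w = Some (emb w).
  by move=> nwi; rewrite /emb /skip_vertex insubT.
have embN w (nwi : w != i) : emb w = inl (exist _ w nwi).
  by rewrite /emb /skip_vertex insubT.
have inrq k : connect e (inr k) (inr q).
  apply: (connect_homo (h := inr)) (connS k) => x y /eqP pxy.
  by apply: connect1; rewrite /e ffunE /parent pxy.
have step x y : val T x == Some y -> connect e (emb x) (emb y).
  move=> /eqP pxy; have [xi|nxi] := eqVneq x i.
    have nyi : y != i.
      apply: contraTneq isT => yi; have := parent_irrefl T i.
      by rewrite /parent -{1}xi pxy yi eqxx.
    have pi : parent T i = Some y by rewrite -xi.
    by apply: connect1; rewrite xi embi /e ffunE pi /parent pq /= skipN.
  rewrite (embN x nxi); have [yi|nyi] := eqVneq y i.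
    have px : parent T x == Some i by rewrite /parent pxy yi.
    rewrite yi embi; apply: connect_trans (inrq (f (exist _ x px))).
    by apply: connect1; rewrite /e ffunE /= insubT.
  apply: connect1; rewrite /e ffunE /= insubF.
    by rewrite /parent pxy /= skipN.
  by rewrite /parent pxy; apply/eqP=> -[yi]; rewrite yi eqxx in nyi.
apply/existsP; exists (emb r); apply/andP; split.
  have [ri|nri] := eqVneq r i.
    have pi : parent T i = None by rewrite -ri.
    by rewrite ri embi ffunE pi /parent pq.
  by rewrite (embN r nri) ffunE /= insubF /parent pr.
apply/forallP=> -[[v nvi]|k]; last first.
  apply: connect_trans (inrq k) _; rewrite -embi.
  exact: connect_homo step _ _ (conn i).
by rewrite -embN; apply: connect_homo step _ _ (conn v).
Qed.

Definition graft : rtree ({v : I | v != i} + J)%type :=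
  exist (fun p : parent_map _ => is_rooted_tree p) _ graft_subproof.

End Graft.

Definition prelie_space n := free_space (rtree 'I_n).

Definition relabel_perm n (s : 'S_n) : rtree 'I_n -> rtree 'I_n :=
  relabel (injF_bij (@perm_inj _ s)).

Definition prelie_act n (s : 'S_n) : prelie_space n -> prelie_space n :=
  lin_ext (fun T => basis_vec (relabel_perm s T)).

Definition tree_comp m n (i : 'I_m.+1) (T : rtree 'I_m.+1) (S : rtree 'I_n) :
    prelie_space (m + n) :=
  \sum_(f : {ffun incoming T i -> 'I_n})
    basis_vec (relabel (glue_bij n i) (graft S f)).

Definition prelie_comp m n (i : 'I_m.+1) (a : prelie_space m.+1)
    (b : prelie_space n) : prelie_space (m + n) :=
  lin_ext (fun T => lin_ext (tree_comp i T) b) a.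

Fact lin_ext2_linearl (B C : finType) (V : lmodType rat) (f : B -> C -> V)
    (b : free_space C) :
  linear (fun a : free_space B => lin_ext (fun x => lin_ext (f x) b) a).
Proof. exact: lin_ext_linear. Qed.

Fact lin_ext2_linearr (B C : finType) (V : lmodType rat) (f : B -> C -> V)
    (a : free_space B) :
  linear (fun b : free_space C => lin_ext (fun x => lin_ext (f x) b) a).
Proof.
move=> c b b'; rewrite {1 3}/lin_ext scaler_sumr -big_split /=.
apply: eq_bigr => x _; rewrite lin_ext_linear scalerDr !scalerA.
by rewrite [a x * c]mulrC.
Qed.

Fact single_vertex_subproof :
  is_rooted_tree ([ffun=> None] : parent_map 'I_1).
Proof.
apply/existsP; exists ord0; rewrite ffunE eqxx /=.
by apply/forallP => v; rewrite (ord1 v) connect0.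
Qed.

Definition single_vertex : rtree 'I_1 :=
  exist (fun p : parent_map 'I_1 => is_rooted_tree p) _ single_vertex_subproof.

Definition PreLie : operad_data :=
  @OperadData prelie_space prelie_act (basis_vec single_vertex) prelie_comp
    (fun n s => lin_ext_linear _)
    (fun m n i => lin_ext2_linearl (tree_comp (n := n) i))
    (fun m n i => lin_ext2_linearr (tree_comp (n := n) i)).

Fact edge_tree_subproof :
  is_rooted_tree ([ffun v : 'I_2 => if v == ord0 then None else Some ord0]
                  : parent_map 'I_2).
Proof.
apply/existsP; exists ord0; rewrite ffunE eqxx /=.
apply/forallP => v; have [->|nv] := eqVneq v ord0; first exact: connect0.
by apply: connect1; rewrite ffunE (negPf nv).
Qed.

Definition edge_tree : rtree 'I_2 :=
  exist (fun p : parent_map 'I_2 => is_rooted_tree p) _ edge_tree_subproof.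

(* The generator x <- y of PreLie: vertex 0 is the root, vertex 1 its child. *)
Definition prelie_gen : PreLie 2 := basis_vec edge_tree.

Definition nonlinear_span n : {pred PreLie n} :=
  mem <<[seq (basis_vec T : prelie_space n)
        | T <- enum [pred T : rtree 'I_n | ~~ is_linear_tree T]]>>%VS.

(* The multilinear monomials x_{w_1} ... x_{w_n} in n noncommuting variables;
   there is no empty one, as the associative algebras are non-unital. *)
Definition word n := {w : n.-tuple 'I_n | (0 < n)%N && uniq w}.

Definition letters n (w : word n) : seq 'I_n := val w.

Lemma letters_uniq n (w : word n) : uniq (letters w).
Proof. by case/andP: (valP w). Qed.

Lemma size_letters n (w : word n) : size (letters w) = n.
Proof. exact: size_tuple. Qed.

Lemma mem_letters n (w : word n) x : x \in letters w.
Proof.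
have /uniq_min_size : uniq (letters w) := letters_uniq w.
move/(_ (enum 'I_n)); rewrite size_enum_ord size_letters leqnn.
case=> // [y _|_ ->]; first by rewrite mem_enum.
by rewrite mem_enum.
Qed.

Fact make_word_subproof n (s : seq 'I_n) (hs : uniq s)
    (hm : forall x, x \in s) : size s == n.
Proof.
rewrite -(card_uniqP hs) -[X in _ == X]card_ord.
by apply/eqP/eq_card => x; rewrite hm.
Qed.

Definition make_word n (s : seq 'I_n) (n0 : (0 < n)%N)
    (hs : uniq s) (hm : forall x, x \in s) : word n :=
  exist (fun w : n.-tuple 'I_n => (0 < n)%N && uniq w)
    (Tuple (make_word_subproof hs hm)) (introT andP (conj n0 hs)).

Lemma word_gt0 n (w : word n) : (0 < n)%N.
Proof. by case/andP: (valP w). Qed.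

Fact act_word_uniq n (s : 'S_n) (w : word n) : uniq (map s (letters w)).
Proof. by rewrite (map_inj_uniq perm_inj) letters_uniq. Qed.

Fact act_word_mem n (s : 'S_n) (w : word n) x : x \in map s (letters w).
Proof. by rewrite -(permKV s x) map_f ?mem_letters. Qed.

Definition act_word n (s : 'S_n) (w : word n) : word n :=
  make_word (word_gt0 w) (act_word_uniq s w) (act_word_mem s w).

Section Substitution.
Variables (m n : nat) (i : 'I_m.+1) (u : word m.+1) (w : word n).

Definition subst_seq : seq 'I_(m + n) :=
  flatten [seq if insub a is Some v then [:: glue i (inl v)]
               else [seq glue i (inr k) | k <- letters w] | a <- letters u].

Fact subst_gt0 : (0 < m + n)%N.
Proof. by rewrite addn_gt0 (word_gt0 w) orbT. Qed.

Fact subst_mem x : x \in subst_seq.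
Proof.
case: (glue_bij n i) => g _ gK; rewrite -(gK x); case: (g x) => [v|k].
  apply/flatten_mapP; exists (val v); rewrite ?mem_letters // valK.
  by rewrite mem_seq1.
apply/flatten_mapP; exists i; rewrite ?mem_letters // insubF ?eqxx //.
exact/map_f/mem_letters.
Qed.

Fact subst_uniq : uniq subst_seq.
Proof.
apply: (leq_size_uniq (enum_uniq 'I_(m + n))) => [x _|]; first exact: subst_mem.
rewrite size_enum_ord size_flatten /shape -map_comp sumnE big_map.
have pu : perm_eq (letters u) (enum 'I_m.+1).
  rewrite uniq_perm ?letters_uniq ?enum_uniq // => x.
  by rewrite mem_letters mem_enum.
rewrite (perm_big _ pu) big_enum (bigD1 i) //= insubF ?eqxx //.
rewrite size_map size_letters (eq_bigr (fun=> 1%N)) => [|j ji]; last first.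
  by rewrite insubT.
by rewrite sum1_card addnC cardC1 card_ord.
Qed.

Definition subst_word : word (m + n) :=
  make_word subst_gt0 subst_uniq subst_mem.

End Substitution.

Definition as_space n := free_space (word n).

Definition as_act n (s : 'S_n) : as_space n -> as_space n :=
  lin_ext (fun w => basis_vec (act_word s w)).

Definition as_comp m n (i : 'I_m.+1) (a : as_space m.+1) (b : as_space n) :
    as_space (m + n) :=
  lin_ext (fun u => lin_ext (fun w => basis_vec (subst_word i u w)) b) a.

(* The monomial x_0 x_1 ... x_{n-1}. *)
Definition std_word n : word n.+1 :=
  make_word (ltn0Sn n) (enum_uniq 'I_n.+1) (mem_enum 'I_n.+1).

Definition As : operad_data :=
  @OperadData as_space as_act (basis_vec (std_word 0)) as_comp
    (fun n s => lin_ext_linear _)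
    (fun m n i => lin_ext2_linearl (fun u w => basis_vec (subst_word i u w)))
    (fun m n i => lin_ext2_linearr (fun u w => basis_vec (subst_word i u w))).

(* The associative product x_0 x_1. *)
Definition as_mul : As 2 := basis_vec (std_word 1).

(* As [prelie_gen] generates the operad PreLie, the map is determined by these
   conditions; they say that the pre-Lie product of an associative algebra is
   its associative product. *)
Definition is_usual_map (phi : forall n, PreLie n -> As n) : Prop :=
  is_operad_morphism phi /\ phi 2%N prelie_gen = as_mul.

(* Main.v *)
Require Import Defs.
From HB Require Import structures.
From mathcomp Require Import all_boot all_algebra.
From mathcomp Require Import perm generic_quotient.

Set Implicit Arguments.
Unset Strict Implicit.
Unset Printing Implicit Defensive.

Import GRing.Theory.
Local Open Scope ring_scope.

(** A linear rooted tree on n labels is the same thing as a word: enumerate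
    its vertices from the root to the leaf.  So sending a linear tree to its
    word and a non-linear tree to zero defines, in each arity, a surjection
    from PreLie onto As whose kernel is spanned by the non-linear trees.  Once
    this surjection ([linear_part]) is known to be a morphism of operads,
    everything follows from the first isomorphism theorem: the kernel is an
    ideal, the quotient by it is As, and the generator, which is the linear
    tree of the word x_0 x_1, is sent to the associative product.

    Only compatibility with composition needs an argument.  The useful
    description of linearity is that the parent map, with values in the
    vertices together with one extra value for the root, is injective
    ([linear_tree_inj]).  It then misses exactly one value, the leaf
    ([missing_unique]).  If a graft of S into T at the vertex i is linear, then:
    - S is linear, as its edges and its root survive in the graft
      ([graft_inj_inner]);
    - every child of i is attached to a vertex of S without children in S,
      hence to the only leaf of S ([graft_inj_missing]);
    - T is linear: two children of i would both be attached to the leaf of S,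
      and edges elsewhere in T survive ([graft_inj_outer]).
    So a composition of two trees contains a linear tree only if both trees
    are linear, and then it contains exactly one, in which the subtree hanging
    from i is moved to the leaf of S; reading it from the root gives the word
    of T with the letter i replaced by the word of S ([graft_reads]), which is
    composition in As. *)

(** * Operads: morphisms and the first isomorphism theorem *)

Lemma linear_zero (V W : lmodType rat) (f : V -> W) : linear f -> f 0 = 0.
Proof.
by move=> L; rewrite -{1}[0]addr0 -{1}[0](scaler0 _ (-1)) L scaleN1r addNr.
Qed.

Lemma linear_sub (V W : lmodType rat) (f : V -> W) :
  linear f -> forall a b, f (a - b) = f a - f b.
Proof. by move=> L a b; rewrite addrC -scaleN1r L scaleN1r addrC. Qed.

Lemma comp_operad_morphism (O P Q : operad_data) (phi : forall n, O n -> P n)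
    (psi : forall n, P n -> Q n) :
  is_operad_morphism phi -> is_operad_morphism psi ->
  is_operad_morphism (fun n a => psi n (phi n a)).
Proof.
case=> [phiL phiA phi1 phiC] [psiL psiA psi1 psiC]; split=> /= *.
- by move=> c a b; rewrite phiL psiL.
- by rewrite phiA psiA.
- by rewrite phi1 psi1.
- by rewrite phiC psiC.
Qed.

(** The ideal is a given family of predicates with a membership criterion
    rather than the kernel by definition, so that the result applies to a
    subspace described otherwise, such as a span. *)
Section FirstIsomorphism.
Variables (O P : operad_data) (I : forall n, {pred O n}).
Variables (phi : forall n, O n -> P n) (sec : forall n, P n -> O n).
Arguments I : clear implicits.
Arguments phi : clear implicits.
Hypothesis phiM : is_operad_morphism phi.
Hypothesis kerE : forall n (a : O n), (a \in I n) = (phi n a == 0).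
Hypothesis secK : forall n, cancel (@sec n) (phi n).

Lemma kernel_ideal : is_operad_ideal I.
Proof.
case: phiM => L A _ C; split.
- move=> n; split=> [|c a b]; rewrite !kerE; first by rewrite (linear_zero (L n)).
  by move=> /eqP a0 /eqP b0; rewrite L a0 b0 scaler0 addr0.
- move=> n s a; rewrite !kerE A => /eqP->.
  by rewrite (linear_zero (@op_act_linear P n s)).
- move=> m n i a b; rewrite !kerE C => /eqP->.
  by rewrite (linear_zero (@op_comp_linearl P m n i _)).
- move=> m n i a b; rewrite !kerE C => /eqP->.
  by rewrite (linear_zero (@op_comp_linearr P m n i _)).
Qed.

Definition induced_map n (x : quotient_operad kernel_ideal n) : P n :=
  phi n (repr (x : quotient_op_space kernel_ideal n)).

Lemma induced_mapE n (a : O n) :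
  induced_map (quotient_map kernel_ideal a) = phi n a.
Proof.
case: phiM => L _ _ _.
have := repr_quotient_op_proj kernel_ideal a; rewrite kerE => /eqP e.
by apply/subr0_eq; rewrite -e linear_sub.
Qed.

Lemma induced_map_isomorphism : is_operad_isomorphism induced_map.
Proof.
have [L A U C] := phiM.
have [qL qA qU qC] := quotient_map_morphism kernel_ideal.
pose q n (a : O n) := quotient_map kernel_ideal a.
have reprK n x : q n (repr (x : quotient_op_space kernel_ideal n)) = x.
  exact: quotient_op_projK.
split; first split.
- move=> n c x y; rewrite -[x]reprK -[y]reprK -qL.
  by rewrite !induced_mapE L.
- by move=> n s x; rewrite -[x]reprK -qA !induced_mapE A.
- by rewrite -qU induced_mapE.
- by move=> m n i x y; rewrite -[x]reprK -[y]reprK -qC !induced_mapE C.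
move=> n; exists (fun b => q n (sec b)) => [x|b]; last first.
  by rewrite induced_mapE secK.
rewrite -[x]reprK induced_mapE; set a := repr _.
apply/eqP; rewrite quotient_op_proj_eq kerE.
by rewrite linear_sub // secK subrr.
Qed.

End FirstIsomorphism.

(** * Free spaces *)

Lemma lin_ext_basis (B : finType) (V : lmodType rat) (f : B -> V) b :
  lin_ext f (basis_vec b) = f b.
Proof.
rewrite /lin_ext (bigD1 b) //= ffunE eqxx scale1r big1 ?addr0 // => x nx.
by rewrite ffunE (negPf nx) scale0r.
Qed.

Lemma basis_decomp (B : finType) (a : free_space B) :
  a = \sum_b a b *: (basis_vec b : free_space B).
Proof.
have scaleE c b x : (c *: (basis_vec b : free_space B)) x = c * (x == b)%:R.
  by rewrite !ffunE.
apply/ffunP=> x; rewrite sum_ffunE (bigD1 x) //= scaleE eqxx mulr1.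
rewrite big1 ?addr0 // => y ny.
by rewrite scaleE eq_sym (negPf ny) mulr0.
Qed.

Lemma linear_sum_basis (B : finType) (V : lmodType rat)
    (f : free_space B -> V) : linear f ->
  forall a, f a = lin_ext (fun b => f (basis_vec b)) a.
Proof.
move=> L a; rewrite [in LHS](basis_decomp a) /lin_ext.
elim/big_rec2: _ => [|b y1 y2 _ <-]; first exact: linear_zero.
by rewrite L.
Qed.

Lemma eq_linear_basis (B : finType) (V : lmodType rat)
    (f g : free_space B -> V) : linear f -> linear g ->
  (forall b, f (basis_vec b) = g (basis_vec b)) -> f =1 g.
Proof.
move=> fL gL fg a; rewrite linear_sum_basis // [RHS]linear_sum_basis //.
by apply: eq_bigr => b _; rewrite fg.
Qed.

(** * Readings of parent maps *)

Section Readings.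
Variable V : finType.
Implicit Types (p : parent_map V) (s : seq V).

(** The value [None] stands for the parent of the root, so that one relation
    handles the root and the other vertices alike. *)
Definition descends p : rel (option V) := fun a b => obind p b == a.

Definition reads p s : bool := path (descends p) None (map Some s).

(** This serves both to recover a parent map from its reading and to build the
    one with a given reading.  As [a] comes before [s], position [index x s] of
    the extended sequence holds the predecessor of [x]. *)
Lemma descends_pathP p a s : uniq s ->
  path (descends p) a (map Some s) <->
  (forall x, x \in s -> p x = nth None (a :: map Some s) (index x s)).
Proof.
elim: s a => [|y s IHs] a //= /andP[ys us]; rewrite /descends /=.
split=> [/andP[/eqP py /IHs-/(_ us) e] x|e].
  rewrite inE; have [->|nxy] /= := eqVneq x y; first by [].
  exact: e.
apply/andP; split; first by rewrite e ?mem_head //= eqxx.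
apply/IHs=> // x xs; rewrite e ?inE ?xs ?orbT //.
by case: eqP => // yx; rewrite yx xs in ys.
Qed.

Section Total.
Variables (p : parent_map V) (s : seq V).
Hypotheses (us : uniq s) (ms : forall x, x \in s) (rs : reads p s).

Lemma reads_parent x : p x = nth None (None :: map Some s) (index x s).
Proof. exact: (descends_pathP p None us).1. Qed.

Lemma uniq_somes : uniq (None :: map Some s).
Proof.
rewrite /= map_inj_uniq ?us ?andbT; last by move=> x y [].
by apply/mapP=> -[].
Qed.

(** Predecessors in a duplicate-free sequence are distinct. *)
Lemma reads_inj : injective p.
Proof.
move=> x y /eqP; rewrite !reads_parent nth_uniq ?uniq_somes //=; last first.
- by rewrite size_map ltnW // ltnS index_mem.
- by rewrite size_map ltnW // ltnS index_mem.
by move=> /eqP e; rewrite -(nth_index x (ms x)) e nth_index.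
Qed.

(** The last position is not the predecessor of any position. *)
Lemma reads_last x : p x != last None (map Some s).
Proof.
have -> : last None (map Some s) = nth None (None :: map Some s) (size s).
  by rewrite -(size_map Some s) -last_nth.
rewrite reads_parent nth_uniq ?uniq_somes //=; rewrite ?size_map ?ltnSn //.
  by rewrite neq_ltn index_mem ms.
by rewrite ltnW // ltnS index_mem.
Qed.

End Total.

(** Each value of an injective parent map is taken once, so from the root on
    the next vertex is forced. *)
Lemma reads_unique p s t : injective p -> size s = size t ->
  reads p s -> reads p t -> s = t.
Proof.
move=> pinj; rewrite /reads; move: None => a.
elim: s t a => [|x s IHs] [|y t] a //= [est].
case/andP=> /eqP px ps /andP[/eqP py pt].
have xy : x = y by apply: pinj; exact: etrans px (esym py).
by rewrite xy in ps *; congr (_ :: _); apply: IHs est ps pt.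
Qed.

(** Counting: an injection from a set into itself with one point added cannot
    miss two values.  For a linear tree the missing value is the leaf. *)
Lemma missing_unique p a b : injective p ->
  (forall x, p x != a) -> (forall x, p x != b) -> a = b.
Proof.
move=> pinj na nb; apply/eqP; apply: contraT => nab.
have: (#|[set p x | x in V] :|: [set a; b]| <= #|{: option V}|)%N.
  exact: max_card.
rewrite cardsU card_option card_imset // cards2 nab.
suff -> : [set p x | x in V] :&: [set a; b] = set0.
  by rewrite cards0 subn0 addn2 ltnn.
apply/setP=> c; rewrite !inE; apply/negP=> /andP[/imsetP[x _ ->]].
by rewrite (negPf (na x)) (negPf (nb x)).
Qed.

Definition reading_map s : parent_map V :=
  [ffun x => nth None (None :: map Some s) (index x s)].

Lemma reading_map_reads s : uniq s -> reads (reading_map s) s.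
Proof. by move=> us; apply/(descends_pathP _ _ us) => x _; rewrite ffunE. Qed.

Lemma path_connect p r s : path (descends p) (Some r) (map Some s) ->
  {in r :: s, forall v, connect (fun x y => p x == Some y) v r}.
Proof.
elim: s r => [|y s IHs] r /= => [_ v|/andP[pyr /IHs conn] v].
  by rewrite inE => /eqP->; apply: connect0.
rewrite inE => /predU1P[->|/conn]; first exact: connect0.
by move/connect_trans; apply; apply: connect1.
Qed.

Lemma reads_rooted p s : s != [::] -> (forall x, x \in s) -> reads p s ->
  is_rooted_tree p.
Proof.
case: s => // r s _ ms /andP[pr /path_connect conn].
by apply/existsP; exists r; rewrite [p r == None]pr; apply/forallP=> v; apply: conn.
Qed.

(** The root-to-leaf enumeration is the orbit of the root under the map
    sending a vertex to its child; the orbit stops because it is finite, and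
    it exhausts the tree because every vertex reaches the root. *)
Lemma inj_reads (T : rtree V) : injective (parent T) ->
  exists s, [/\ uniq s, forall x, x \in s & reads (parent T) s].
Proof.
move=> pinj; case/existsP: (valP T) => r /andP[/eqP pr /forallP conn].
pose p := parent T; pose child v := odflt v [pick y | p y == Some v].
have childE x y : p y = Some x -> child x = y.
  move=> pyx; rewrite /child; case: pickP => [z /eqP pz|/(_ y)] /=.
    by apply: pinj; rewrite pyx.
  by rewrite pyx eqxx.
have childN x : child x != x -> p (child x) = Some x.
  by rewrite /child; case: pickP => [y /eqP|_] //=; rewrite eqxx.
exists (orbit child r); split; first exact: orbit_uniq.
  move=> v; rewrite -fconnect_orbit.
  case/connectP: (conn v) => q + def_r.
  elim: q v def_r => [|w q IHq] v /= => [-> _|]; first exact: connect0.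
  move=> def_r /andP[/eqP/childE<- pq].
  by apply: connect_trans (fconnect1 _ _); apply: IHq.
have -> : orbit child r = traject child r (order child r) by [].
have: uniq (traject child r (order child r)) by exact: orbit_uniq.
rewrite -orderSpred /reads /= /descends /= => /andP[].
rewrite {1}/parent pr eqxx /=; move: _.-1 => k.
elim: k r {pr conn} => [|k IHk] r //=; rewrite inE negb_or.
by move=> /andP[nr _] /andP[? ?]; rewrite childN ?eqxx 1?eq_sym //= IHk.
Qed.

(** Linearity bounds the number of children of a vertex; the uniqueness of the
    root, which injectivity at the value [None] demands, is automatic. *)
Lemma linear_tree_inj (T : rtree V) :
  reflect (injective (parent T)) (is_linear_tree T).
Proof.
apply: (iffP forallP) => [lin x y|pinj v]; last first.
  apply/card_le1_eqP => x y; rewrite !inE => /eqP px /eqP py.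
  by apply: pinj; rewrite px py.
case px: (parent T x) => [v|] py.
  by apply: (card_le1_eqP (lin v)); rewrite inE ?px -?py.
case/existsP: (valP T) => r /andP[_ /forallP conn].
have root z : parent T z = None -> z = r.
  move=> pz; case/connectP: (conn z) => -[|w q] //= /andP[].
  by move: pz; rewrite /parent => ->.
by rewrite (root x) // (root y).
Qed.

End Readings.

(** * Relabelling and grafting *)

Section RelabelReads.
Variables (V W : finType) (h : V -> W).
Hypothesis hbij : bijective h.

Lemma relabel_reads (p : parent_map V) s :
  reads p s -> reads (relabel_map h p) (map h s).
Proof.
rewrite /reads -[None in X in _ -> X]/(omap h None); move: None => a.
elim: s a => //= x s IHs a /andP[/eqP/= px /IHs ->].
by rewrite andbT /descends /= relabel_mapE // px.
Qed.

Lemma relabel_inj (p : parent_map V) :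
  injective (relabel_map h p) -> injective p.
Proof.
move=> rinj x y pxy; apply/(bij_inj hbij)/rinj.
by rewrite !relabel_mapE // pxy.
Qed.

End RelabelReads.

Section GraftReads.
Variables (I J : finType) (T : rtree I) (i : I) (S : rtree J).

Section Inj.
Variable f : {ffun incoming T i -> J}.
Hypothesis ginj : injective (graft_map S f).
Local Notation g := (graft_map S f).

Lemma graft_inl_child x (nxi : x != i) (e : parent T x == Some i) :
  g (inl (exist _ x nxi)) = Some (inr (f (exist _ x e))).
Proof. by rewrite ffunE /= insubT. Qed.

Lemma graft_inl x (nxi : x != i) : parent T x != Some i ->
  g (inl (exist _ x nxi)) = obind (skip_vertex J i) (parent T x).
Proof. by move=> e; rewrite ffunE /= insubF //; apply: negPf. Qed.

Lemma graft_inj_inner : injective (parent S).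
Proof.
by move=> k l e; have /ginj[] : g (inr k) = g (inr l) by rewrite !ffunE e.
Qed.

Lemma child_neq x : parent T x == Some i -> x != i.
Proof. by apply: contraTneq => ->; apply: parent_irrefl. Qed.

(** A vertex of [S] that receives a child from [T] has none in [S], as the two
    children would share a parent. *)
Lemma graft_inj_missing e k : parent S k != Some (f e).
Proof.
apply/eqP=> pk; case: e pk => x e pk.
have /ginj// : g (inr k) = g (inl (exist _ x (child_neq e))).
by rewrite (graft_inl_child _ e) ffunE pk.
Qed.

(** Two children of [i] are attached to vertices without children in [S], hence
    to the same vertex, and injectivity of the graft identifies them.  Children
    of the other vertices keep their parent, the root of [S] standing for
    [i]. *)
Lemma graft_inj_outer : injective (parent T).
Proof.
case/existsP: (valP S) => q /andP[/eqP pq _].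
have gq : g (inr q) = obind (skip_vertex J i) (parent T i).
  by rewrite ffunE /parent pq.
move=> x y pxy; have [exi|nxi] := boolP (parent T x == Some i).
  have eyi : parent T y == Some i by rewrite -pxy.
  have fxy : f (exist _ x exi) = f (exist _ y eyi).
    by apply/Some_inj/(missing_unique graft_inj_inner) => k;
       apply: graft_inj_missing.
  have /ginj[] // : g (inl (exist _ x (child_neq exi)))
                  = g (inl (exist _ y (child_neq eyi))).
  by rewrite (graft_inl_child _ exi) (graft_inl_child _ eyi) fxy.
have nyi : parent T y != Some i by rewrite -pxy.
(* A sibling of [i] would become a sibling of the root of [S]. *)
have rootN z : z != i -> parent T z != parent T i.
  move=> zi; apply/eqP=> pz.
  have /ginj : g (inr q) = g (inl (exist _ z zi)); last by [].
  by rewrite gq graft_inl pz // parent_irrefl.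
have [xi|xi] := eqVneq x i; have [yi|yi] := eqVneq y i; first by rewrite xi.
- by have := rootN y yi; rewrite -pxy xi eqxx.
- by have := rootN x xi; rewrite pxy yi eqxx.
have /ginj[] // : g (inl (exist _ x xi)) = g (inl (exist _ y yi)).
by rewrite !graft_inl // pxy.
Qed.

End Inj.

Definition block (w : seq J) (a : I) : seq ({v : I | v != i} + J) :=
  if insub a is Some v then [:: inl v] else map inr w.

(** Walking through [u], each step of [T] away from [i] is a step of the graft;
    at [i] the walk enters [S] at its root, follows [w], and leaves from the
    last vertex [l], to which the children of [i] are attached. *)
Lemma graft_reads (u : seq I) (w : seq J) l :
  reads (parent T) u -> reads (parent S) w -> last None (map Some w) = Some l ->
  reads (graft_map S ([ffun=> l] : {ffun incoming T i -> J}))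
        (flatten (map (block w) u)).
Proof.
set g := graft_map _ _ => Tu Sw lw.
(* [F] sends a vertex of T to the vertex of the graft that its children
   descend from, so that the parent in the graft of a vertex of T other than
   [i] is [F] of its parent in T. *)
pose F b := if b == Some i then Some (inr l) else obind (skip_vertex J i) b.
have gl v : g (inl v) = F (parent T (val v)).
  rewrite ffunE /F; case: insubP => [e /= pe _|/negPf-> //].
  by rewrite pe ffunE.
have gr : path (descends g) (F (parent T i))
            (map Some (map inr w : seq ({v : I | v != i} + J))).
  (* [H] plays the same part for S, whose root hangs below the parent of i. *)
  pose H b := if b is Some k then Some (inr k) else F (parent T i).
  move: Sw; rewrite /reads -[F _]/(H None); move: None => b.
  elim: w {lw} b => //= k w IHw b /andP[/eqP/= pk /IHw ->].
  rewrite andbT /descends /= ffunE pk /H; case: b {pk} => //=.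
  by rewrite /F (negPf (parent_irrefl _ _)).
have lr a : last a (map Some (map inr w : seq ({v : I | v != i} + J)))
            = Some (inr l).
  by case: w lw {Sw gr} => // k w; rewrite /= -map_comp !last_map => -[->].
move: Tu; rewrite /reads -[None in X in _ -> X]/(F None); move: None => a.
elim: u a => //= x u IHu a /andP[/eqP/= px /IHu pu].
rewrite map_cat cat_path; have [xi|nxi] := eqVneq x i.
  have -> : block w x = map inr w by rewrite /block insubF // xi eqxx.
  by rewrite -px xi gr lr; move: pu; rewrite xi /F eqxx.
have -> : block w x = [:: inl (exist _ x nxi)] by rewrite /block insubT.
rewrite /= {1}/descends /= gl /= px eqxx /=.
by move: pu; rewrite /F (inj_eq Some_inj) (negPf nxi) /= /skip_vertex insubT.
Qed.

End GraftReads.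

(** * Words as linear trees *)

Section WordTrees.
Variable n : nat.
Implicit Types (w : word n) (T : rtree 'I_n).

Fact word_tree_subproof w : is_rooted_tree (reading_map (letters w)).
Proof.
have rw := reading_map_reads (letters_uniq w).
apply: reads_rooted (mem_letters w) rw.
by rewrite -size_eq0 size_letters -lt0n word_gt0.
Qed.

Definition word_tree w : rtree 'I_n :=
  exist (fun p : parent_map 'I_n => is_rooted_tree p) _ (word_tree_subproof w).

Lemma word_tree_reads w : reads (parent (word_tree w)) (letters w).
Proof. exact: reading_map_reads (letters_uniq w). Qed.

Lemma word_tree_parent_inj w : injective (parent (word_tree w)).
Proof.
exact: reads_inj (letters_uniq w) (mem_letters w) (word_tree_reads w).
Qed.

Lemma word_treeP T w :
  reflect (reads (parent T) (letters w)) (T == word_tree w).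
Proof.
apply: (iffP eqP) => [->|r]; first exact: word_tree_reads.
apply/val_inj/ffunP => x.
by rewrite [LHS](reads_parent (letters_uniq w) (mem_letters w) r) ffunE.
Qed.

Lemma word_tree_inj : injective word_tree.
Proof.
move=> u w e; apply/val_inj/val_inj.
apply: (reads_unique (word_tree_parent_inj (w := u))).
- by rewrite !size_letters.
- exact: word_tree_reads.
- by rewrite e; apply: word_tree_reads.
Qed.

Lemma linear_word_tree T : is_linear_tree T -> exists w, T = word_tree w.
Proof.
move=> /linear_tree_inj Tinj; have [s [us ms rs]] := inj_reads Tinj.
have n0 : (0 < n)%N.
  by case/existsP: (valP T) => r _; apply: leq_ltn_trans (ltn_ord r).
by exists (make_word n0 us ms); apply/eqP/word_treeP.
Qed.

End WordTrees.

(** * The coordinate map from PreLie to As *)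

(** As trees form a basis, reading off the coefficients of the trees of words
    is the linear map that kills the non-linear trees and sends the tree of a
    word to that word. *)
Definition linear_part n (a : PreLie n) : As n :=
  ([ffun w => (a : prelie_space n) (word_tree w)] : as_space n).

Definition word_combination n : As n -> PreLie n :=
  lin_ext (fun w => basis_vec (word_tree w) : PreLie n).

Lemma linear_part_linear n : linear (@linear_part n).
Proof. by move=> c a b; apply/ffunP=> w; rewrite !ffunE. Qed.

Lemma linear_part_word n (w : word n) :
  linear_part (basis_vec (word_tree w)) = basis_vec w.
Proof.
by apply/ffunP=> u; rewrite !ffunE (inj_eq (@word_tree_inj n)).
Qed.

Lemma linear_part_nonlinear n (T : rtree 'I_n) :
  ~~ is_linear_tree T -> linear_part (basis_vec T) = 0.
Proof.
move=> Tnl; apply/ffunP=> u; rewrite !ffunE.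
case: eqP => // Tu; case/negP: Tnl; rewrite -Tu.
exact/linear_tree_inj/word_tree_parent_inj.
Qed.

Lemma word_combinationK n : cancel (@word_combination n) (@linear_part n).
Proof.
apply: eq_linear_basis => [c a b||w] //.
  by rewrite /word_combination lin_ext_linear linear_part_linear.
by rewrite /word_combination lin_ext_basis linear_part_word.
Qed.

(** For the converse inclusion, a combination in the kernel has coefficient
    zero on the trees of words, which are all the linear trees. *)
Lemma nonlinear_spanE n (a : PreLie n) :
  (a \in @nonlinear_span n) = (linear_part a == 0).
Proof.
apply/idP/eqP => [|a0].
  pose L := GRing.isLinear.Build _ _ _ _ _ (@linear_part_linear n).
  pose phi : {linear prelie_space n -> as_space n} := HB.pack (@linear_part n) L.
  move=> aS; suff: a \in lker (linfun phi).
    by rewrite memv_ker lfunE => /eqP.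
  apply: subvP aS; apply/span_subvP=> _ /mapP[T + ->].
  by rewrite mem_enum memv_ker lfunE => /linear_part_nonlinear/= ->.
rewrite (basis_decomp a); apply: memv_suml => T _.
have [/linear_word_tree[w ->]|Tnl] := boolP (is_linear_tree T).
  by move/ffunP/(_ w): a0; rewrite !ffunE => ->; rewrite scale0r mem0v.
apply/memvZ/memv_span/mapP; exists T => //.
by rewrite mem_enum.
Qed.

Lemma linear_part_act n (s : 'S_n) (a : PreLie n) :
  linear_part (op_act s a) = op_act s (linear_part a).
Proof.
move: a; refine (@eq_linear_basis (rtree 'I_n) (As n) _ _ _ _ _).
- by move=> c a b; rewrite op_act_linear linear_part_linear.
- by move=> c a b; rewrite linear_part_linear op_act_linear.
move=> T; rewrite [op_act s _]lin_ext_basis.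
have [/linear_word_tree[w ->]|Tnl] := boolP (is_linear_tree T).
  rewrite linear_part_word [RHS]lin_ext_basis -linear_part_word.
  congr (linear_part (basis_vec _)); apply/eqP/word_treeP.
  exact: relabel_reads (injF_bij perm_inj) _ _ (word_tree_reads w).
rewrite (linear_part_nonlinear Tnl) (linear_zero (@op_act_linear As n s)).
apply: linear_part_nonlinear; apply: contra Tnl => /linear_tree_inj rinj.
exact/linear_tree_inj/(relabel_inj _ rinj)/injF_bij/perm_inj.
Qed.

Lemma linear_part_unit : linear_part (op_unit PreLie) = op_unit As.
Proof.
rewrite -[RHS]linear_part_word; congr (linear_part (basis_vec _)).
apply/eqP/word_treeP; rewrite /letters /= enum_ordSl.
rewrite (size0nil (size_enum_ord 0)) /=.
by rewrite /reads /= /descends /= !ffunE.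
Qed.

Lemma linear_part_gen : linear_part prelie_gen = as_mul.
Proof.
rewrite -[RHS]linear_part_word; congr (linear_part (basis_vec _)).
apply/eqP/word_treeP; rewrite /letters /= !enum_ordSl.
rewrite (size0nil (size_enum_ord 0)) /=.
by rewrite /reads /= /descends /= !ffunE.
Qed.

Section TreeComposition.
Variables (m n : nat) (i : 'I_m.+1).

Let comp_tree (T : rtree 'I_m.+1) (S : rtree 'I_n)
    (f : {ffun incoming T i -> 'I_n}) : rtree 'I_(m + n) :=
  relabel (glue_bij n i) (graft S f).

Lemma comp_tree_linear T S (f : {ffun incoming T i -> 'I_n}) :
  is_linear_tree (comp_tree S f) -> injective (graft_map S f).
Proof. by move/linear_tree_inj/(relabel_inj (glue_bij n i)). Qed.

Lemma subst_seqE (u : word m.+1) (w : word n) :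
  subst_seq i u w = map (glue i) (flatten (map (block i (letters w)) (letters u))).
Proof.
rewrite map_flatten -map_comp /subst_seq; congr flatten; apply: eq_map => a /=.
by rewrite /block; case: insub => //; rewrite -map_comp.
Qed.

(** The only graft that contributes is the one along the constant map to the
    leaf [l] of the inner tree. *)
Lemma linear_part_comp_words (u : word m.+1) (w : word n) :
  linear_part (tree_comp i (word_tree u) (word_tree w) : PreLie (m + n)%N)
  = basis_vec (subst_word i u w).
Proof.
set T := word_tree u; set S := word_tree w.
have [l lw] : {l | last None (map Some (letters w)) = Some l}.
  by case: (letters w) (size_letters w) (word_gt0 w) => [|k s] /=;
    [move=> <-|exists (last k s); rewrite last_map].
rewrite [tree_comp _ _ _](bigD1 [ffun=> l]) //=.
pose f0 : {ffun incoming T i -> 'I_n} := [ffun=> l].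
have -> : relabel (glue_bij n i) (graft S f0)
        = word_tree (subst_word i u w).
  apply/eqP/word_treeP; rewrite /letters /= subst_seqE.
  apply: (relabel_reads (glue_bij n i)).
  by apply: graft_reads lw; apply: word_tree_reads.
rewrite -[X in X + _]scale1r linear_part_linear scale1r linear_part_word.
rewrite [X in _ + X](_ : _ = 0) ?addr0 //.
apply: (big_ind (fun a : PreLie (m + n)%N => linear_part a = 0)).
- exact: linear_zero (@linear_part_linear _).
- move=> a b a0 b0.
  by rewrite -[a]scale1r linear_part_linear a0 b0 scaler0 addr0.
move=> f nf; apply: linear_part_nonlinear; apply: contra nf.
move=> /comp_tree_linear ginj; apply/eqP/ffunP=> e; rewrite ffunE.
apply/Some_inj/(missing_unique (graft_inj_inner ginj)) => k.
  exact: graft_inj_missing ginj _ _.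
rewrite -lw.
exact: reads_last (letters_uniq w) (mem_letters w) (word_tree_reads w) k.
Qed.

Lemma linear_part_comp_nonlinear (T : rtree 'I_m.+1) (S : rtree 'I_n) :
  ~~ (is_linear_tree T && is_linear_tree S) ->
  linear_part (tree_comp i T S : PreLie (m + n)%N) = 0.
Proof.
move=> nl; apply: (big_ind (fun a : PreLie (m + n)%N => linear_part a = 0)).
- exact: linear_zero (@linear_part_linear _).
- move=> a b a0 b0.
  by rewrite -[a]scale1r linear_part_linear a0 b0 scaler0 addr0.
move=> f _; apply: linear_part_nonlinear; apply: contra nl.
move=> /comp_tree_linear ginj; apply/andP; split; apply/linear_tree_inj.
  exact: graft_inj_outer ginj.
exact: graft_inj_inner ginj.
Qed.

Lemma linear_part_comp (a : PreLie m.+1) (b : PreLie n) :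
  linear_part (op_comp i a b) = op_comp i (linear_part a) (linear_part b).
Proof.
move: a; refine (@eq_linear_basis (rtree 'I_m.+1) (As (m + n)) _ _ _ _ _).
- by move=> c x y; rewrite op_comp_linearl linear_part_linear.
- by move=> c x y; rewrite linear_part_linear op_comp_linearl.
move=> T; move: b; refine (@eq_linear_basis (rtree 'I_n) (As (m + n)) _ _ _ _ _).
- by move=> c x y; rewrite op_comp_linearr linear_part_linear.
- by move=> c x y; rewrite linear_part_linear op_comp_linearr.
move=> S; rewrite [op_comp i (basis_vec T : PreLie _) _]lin_ext_basis.
rewrite lin_ext_basis.
have [/linear_word_tree[u ->]|Tnl] := boolP (is_linear_tree T); last first.
  rewrite linear_part_comp_nonlinear ?negb_and ?Tnl //.
  rewrite (linear_part_nonlinear Tnl).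
  by rewrite (linear_zero (@op_comp_linearl As m n i _)).
have [/linear_word_tree[w ->]|Snl] := boolP (is_linear_tree S); last first.
  rewrite linear_part_comp_nonlinear ?negb_and ?Snl ?orbT //.
  rewrite (linear_part_nonlinear Snl).
  by rewrite (linear_zero (@op_comp_linearr As m n i _)).
rewrite linear_part_comp_words !linear_part_word.
by rewrite [RHS]lin_ext_basis lin_ext_basis.
Qed.

End TreeComposition.

Lemma linear_part_morphism : is_operad_morphism linear_part.
Proof.
split; [exact: linear_part_linear | exact: linear_part_act
  | exact: linear_part_unit | exact: linear_part_comp].
Qed.

Theorem proposition5 :
  exists (I_ideal : @is_operad_ideal PreLie nonlinear_span)
         (psi : forall n : nat, quotient_operad I_ideal n -> As n),
    is_operad_isomorphism psi /\
    is_usual_map (fun n (a : PreLie n) => psi n (quotient_map I_ideal a)).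
Proof.
exists (kernel_ideal linear_part_morphism nonlinear_spanE).
exists (@induced_map _ _ _ _ linear_part_morphism nonlinear_spanE).
have iso := induced_map_isomorphism linear_part_morphism nonlinear_spanE
  word_combinationK.
split=> //; split; last by rewrite induced_mapE linear_part_gen.
exact: comp_operad_morphism (quotient_map_morphism _) (proj1 iso).
Qed.
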